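(* Let $n$ be a nonzero even integer. Then $$\int_0^{1}\frac{\cos (n \sin^{-1}t)\,\cosh (n \sinh^{-1}t)}{\cos (2 n \sin^{-1}t)+\cosh (2 n \sinh^{-1}t)}\;\frac{t\,dt}{\sqrt{1-t^4}}=0.$$
   Context: Here $\sin^{-1}$ and $\sinh^{-1}$ denote the (principal) inverse functions $\arcsin$ and $\operatorname{arcsinh}$, not reciprocals. *)

(* Defs.v *)
(* An integral over [0, 1) of a function unbounded at 1 is rendered as
   [is_RInt_gen f (at_point 0) (at_left 1) l]: the integrals over [0, b] exist
   for b < 1 close to 1 and tend to l as b increases to 1.  The value of f
   at 1 plays no role. *)
From Stdlib Require Export Reals ZArith.
From Coquelicot Require Export Coquelicot.

(* Main.v *)
Require Import Defs.
From Stdlib Require Import Reals ZArith.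
From Coquelicot Require Import Coquelicot.
From Stdlib Require Import List Lia Lra.
Open Scope R_scope.

(** Put [w = arcsin t + i arcsinh t] and [t ^ 2 = sin theta]; then
    [cos w = exp (- i theta)], the trigonometric factor is [Re (1 / cos (n w)) / 2]
    and [t dt / sqrt (1 - t ^ 4) = d theta / 2].  For [n = 2 m],
    [cos (n w) = T_m (2 s - 1)] with [s = exp (- 2 i theta)] and [T_m] the Chebyshev
    polynomial, which as a polynomial in [s] has [m] distinct roots [a], all in (0, 1).
    By partial fractions it suffices to integrate [Re (1 / (s - a))] over
    0 < theta < pi/2; it has the antiderivative [Arg (1 - a s) / (2 a)], which
    vanishes at both ends. *)

(** * Polynomial functions on the complex numbers and their reciprocals *)

(* [p] is a polynomial function of degree at most [m] whose coefficient of [z ^ m] is [c]. *)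
Fixpoint is_poly (m : nat) (c : C) (p : C -> C) : Prop :=
  match m with
  | O => forall z, p z = c
  | S m => exists (q : C -> C) (d : C), is_poly m c q /\ forall z, p z = (z * q z + d)%C
  end.

Lemma is_poly_plus (m : nat) : forall (c c' : C) (p p' : C -> C),
  is_poly m c p -> is_poly m c' p' -> is_poly m (c + c')%C (fun z => p z + p' z)%C.
Proof.
induction m as [|m IH]; simpl; intros c c' p p'.
- intros H H' z. now rewrite H, H'.
- intros (q & d & Hq & H) (q' & d' & Hq' & H').
  exists (fun z => q z + q' z)%C, (d + d')%C. split; [now apply IH|].
  intros z. rewrite H, H'. ring.
Qed.

Lemma is_poly_scal (m : nat) (k : C) : forall (c : C) (p : C -> C),
  is_poly m c p -> is_poly m (k * c)%C (fun z => k * p z)%C.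
Proof.
induction m as [|m IH]; simpl; intros c p.
- intros H z. now rewrite H.
- intros (q & d & Hq & H).
  exists (fun z => k * q z)%C, (k * d)%C. split; [now apply IH|].
  intros z. rewrite H. ring.
Qed.

(** The leading coefficient may be zero, so summands of lower degree can be padded to a common
    degree before they are added. *)
Lemma is_poly_S (m : nat) : forall (c : C) (p : C -> C),
  is_poly m c p -> is_poly (S m) 0 p.
Proof.
induction m as [|m IH]; intros c p.
- intros H. exists (fun _ => 0%C), c. split; [easy|].
  intros z. rewrite (H z). ring.
- intros (q & d & Hq & H).
  exists q, d. split; [now apply (IH c)|easy].
Qed.

(** Synthetic division: if [p = z q + d] and [q = (z - a) r + q a], the quotient of [p] by [z - a]
    is [z r + q a]. *)
Lemma is_poly_factor (m : nat) : forall (c a : C) (p : C -> C), is_poly (S m) c p ->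
  exists q, is_poly m c q /\ forall z, p z = ((z - a) * q z + p a)%C.
Proof.
induction m as [|m IH]; intros c a p (q & d & Hq & H).
- exists q. split; [easy|]. intros z. simpl in Hq. rewrite !H, !Hq. ring.
- destruct (IH c a q Hq) as (r & Hr & Hqr).
  exists (fun z => z * r z + q a)%C. split.
  + now exists r, (q a).
  + intros z. rewrite !H, (Hqr z). ring.
Qed.

Fixpoint prod_inv (l : list R) (z : C) : C :=
  match l with
  | nil => 1%C
  | a :: l => (/ (z - a) * prod_inv l z)%C
  end.

(** Dividing out one root leaves a quotient that still vanishes at the others, since these are
    distinct from it; with as many roots as the degree, only the constant [c] is left. *)
Lemma is_poly_inv (l : list R) (z : C) (c : C) : c <> 0 :> C ->
  NoDup l -> (forall a : R, In a l -> z <> a) ->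
  forall p, is_poly (length l) c p -> (forall a : R, In a l -> p a = 0) ->
  p z <> 0 /\ (/ p z = / c * prod_inv l z)%C.
Proof.
intros Hc. induction l as [|a l IH]; simpl; intros Hl Hz p Hp H0.
- rewrite Hp. split; [easy|ring].
- inversion_clear Hl as [|? ? Ha Hl'].
  destruct (is_poly_factor _ c a p Hp) as (q & Hq & Hpq).
  assert (Hpa : p a = 0) by (apply H0; now left).
  rewrite Hpa in Hpq.
  assert (Hza : (z - a)%C <> 0).
  { intros E. apply (Hz a); [now left|]. now apply Ceq_minus. }
  destruct (IH Hl') with (p := q) as (Hqz & Hqi); [now auto|easy| |].
  + intros b Hb. assert (Hb0 : p b = 0) by auto. rewrite Hpq in Hb0.
    assert (Hab : (b - a)%C <> 0).
    { intros E. rewrite <- RtoC_minus in E. apply RtoC_inj in E.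
      apply Ha. now replace a with b by lra. }
    replace (q b) with (/ (b - a) * ((b - a) * q b + 0))%C by (field; exact Hab).
    rewrite Hb0. ring.
  + rewrite Hpq. replace ((z - a) * q z + 0)%C with ((z - a) * q z)%C by ring.
    split; [now apply Cmult_neq_0|].
    replace (/ ((z - a) * q z))%C with (/ (z - a) * / q z)%C by (field; now split).
    rewrite Hqi. ring.
Qed.

(** * Shifted Chebyshev polynomials *)

(* [T_k (2 z - 1)], where [T_k] is the Chebyshev polynomial of the first kind. *)
Fixpoint cheb (k : nat) (z : C) : C :=
  match k with
  | O => 1%C
  | S O => (2 * z - 1)%C
  | S (S k as k') => (2 * (2 * z - 1) * cheb k' z - cheb k z)%C
  end.

Lemma cheb_SS (k : nat) (z : C) :
  cheb (S (S k)) z = (2 * (2 * z - 1) * cheb (S k) z - cheb k z)%C.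
Proof. reflexivity. Qed.

Lemma is_poly_cheb (k : nat) :
  (exists c : R, is_poly k c (cheb k)) /\
  exists c : R, c <> 0 /\ is_poly (S k) c (cheb (S k)).
Proof.
induction k as [|k [[c Hk] [c' [Hc' HSk]]]].
- split.
  + now exists 1.
  + exists 2. split; [lra|].
    exists (fun _ => 2%C), (-(1))%C. split; [easy|]. intros z. simpl. ring.
- split; [now exists c'|].
  (* The factor [2 (2 z - 1) = 4 z - 2] of the recurrence multiplies the leading coefficient by 4;
     the other terms have lower degree. *)
  exists (4 * c'). split; [lra|].
  assert (H1 : is_poly (S (S k)) (4 * c')%C (fun z => z * (4 * cheb (S k) z) + 0)%C).
  { exists (fun z => 4 * cheb (S k) z)%C, 0%C. split; [now apply is_poly_scal|easy]. }
  assert (H2 := is_poly_S _ _ _ (is_poly_scal _ (-(2))%C _ _ HSk)).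
  assert (H3 := is_poly_S _ _ _ (is_poly_S _ _ _ (is_poly_scal _ (-(1))%C _ _ Hk))).
  assert (H := is_poly_plus _ _ _ _ _ H1 (is_poly_plus _ _ _ _ _ H2 H3)).
  replace (4 * c' + (0 + 0))%C with (RtoC (4 * c')) in H by (rewrite RtoC_mult; ring).
  destruct H as (q & d & Hq & H).
  exists q, d. split; [exact Hq|]. intros z.
  rewrite <- H, cheb_SS. ring.
Qed.

(** * The cosine of a complex argument *)

(* [cos (x + i y)] *)
Definition ccos (x y : R) : C := (cos x * cosh y, - (sin x * sinh y)).

Lemma cosh_plus (x y : R) : cosh (x + y) = cosh x * cosh y + sinh x * sinh y.
Proof.
unfold cosh, sinh. rewrite Ropp_plus_distr, !exp_plus. field.
Qed.

Lemma sinh_plus (x y : R) : sinh (x + y) = sinh x * cosh y + cosh x * sinh y.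
Proof.
unfold cosh, sinh. rewrite Ropp_plus_distr, !exp_plus. field.
Qed.

Lemma cosh_opp (x : R) : cosh (- x) = cosh x.
Proof. unfold cosh. rewrite Ropp_involutive. field. Qed.

Lemma sinh_opp (x : R) : sinh (- x) = - sinh x.
Proof. unfold sinh. rewrite Ropp_involutive. field. Qed.

Lemma cosh_sq (x : R) : cosh x * cosh x = 1 + sinh x * sinh x.
Proof.
unfold cosh, sinh. rewrite exp_Ropp. field. apply Rgt_not_eq, exp_pos.
Qed.

(** This is the Chebyshev recurrence, written for complex angles. *)
Lemma ccos_add_sub (x y u v : R) :
  (ccos (x + u) (y + v) + ccos (x - u) (y - v) = 2 * ccos u v * ccos x y)%C.
Proof.
unfold ccos, Rminus.
rewrite !cos_plus, !sin_plus, !cosh_plus, !sinh_plus, cos_neg, sin_neg, cosh_opp, sinh_opp.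
apply injective_projections; simpl; ring.
Qed.

(** [T_k (cos w) = cos (k w)] at [w = x + i y]. The recurrence has order two, so the induction
    carries two consecutive indices. *)
Lemma cheb_ccos (x y : R) (z : C) (k : nat) : (2 * z - 1)%C = ccos x y ->
  cheb k z = ccos (INR k * x) (INR k * y).
Proof.
intros Hz.
cut (cheb k z = ccos (INR k * x) (INR k * y) /\
     cheb (S k) z = ccos (INR (S k) * x) (INR (S k) * y)); [easy|].
induction k as [|k [IH IH']].
- split; [|simpl; rewrite !Rmult_1_l; exact Hz].
  simpl. unfold ccos. rewrite !Rmult_0_l, cos_0, cosh_0, sin_0.
  apply injective_projections; simpl; ring.
- split; [exact IH'|].
  rewrite cheb_SS, Hz, IH, IH', <- ccos_add_sub.
  replace (INR (S (S k)) * x) with (INR (S k) * x + x) by (rewrite (S_INR (S k)); ring).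
  replace (INR (S (S k)) * y) with (INR (S k) * y + y) by (rewrite (S_INR (S k)); ring).
  replace (INR (S k) * x - x) with (INR k * x) by (rewrite (S_INR k); ring).
  replace (INR (S k) * y - y) with (INR k * y) by (rewrite (S_INR k); ring).
  ring.
Qed.

(** * Roots of the shifted Chebyshev polynomials *)

(** The zero [cos ((2 k + 1) pi / (2 m))] of [T_m], carried back through [z -> 2 z - 1]. *)
Definition cheb_root (m k : nat) : R := (1 + cos ((2 * INR k + 1) * PI / (2 * INR m))) / 2.

Lemma cheb_root_angle (m k : nat) : (k < m)%nat ->
  0 < (2 * INR k + 1) * PI / (2 * INR m) < PI.
Proof.
intros H. assert (Hk := pos_INR k). assert (Hp := PI_RGT_0).
assert (Hm : INR k + 1 <= INR m) by (rewrite <- S_INR; now apply le_INR).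
split.
- apply Rdiv_lt_0_compat; nra.
- apply Rlt_div_l; nra.
Qed.

Lemma cheb_root_bound (m k : nat) : (k < m)%nat -> 0 < cheb_root m k < 1.
Proof.
intros H. destruct (cheb_root_angle m k H) as [H1 H2]. unfold cheb_root.
set (y := _ / _) in *.
assert (Hp := PI_RGT_0).
assert (cos y < cos 0) by (apply cos_decreasing_1; lra).
assert (cos PI < cos y) by (apply cos_decreasing_1; lra).
rewrite cos_0 in *. rewrite cos_PI in *. lra.
Qed.

Lemma cheb_root_inj (m k k' : nat) : (k < m)%nat -> (k' < m)%nat ->
  cheb_root m k = cheb_root m k' -> k = k'.
Proof.
intros Hk Hk' E.
assert (Hy := cheb_root_angle m k Hk). assert (Hy' := cheb_root_angle m k' Hk').
assert (Hp := PI_RGT_0). unfold cheb_root in E.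
assert (E' := f_equal (fun t => acos (2 * t - 1)) E). simpl in E'.
replace (2 * _ - 1) with (cos ((2 * INR k + 1) * PI / (2 * INR m))) in E' by field.
replace (2 * _ - 1) with (cos ((2 * INR k' + 1) * PI / (2 * INR m))) in E' by field.
rewrite !acos_cos in E' by lra.
assert (Hm : 0 < INR m) by (apply lt_0_INR; lia).
apply INR_eq.
replace (INR k) with (((2 * INR k + 1) * PI / (2 * INR m)) * INR m / PI - / 2) by (field; lra).
rewrite E'. field. lra.
Qed.

(** [m] times the angle of the root is [pi / 2 + k pi], where the cosine vanishes. *)
Lemma cheb_root_0 (m k : nat) : (k < m)%nat -> cheb m (cheb_root m k) = 0.
Proof.
intros H. assert (Hm : 0 < INR m) by (apply lt_0_INR; lia).
rewrite (cheb_ccos ((2 * INR k + 1) * PI / (2 * INR m)) 0).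
- unfold ccos. rewrite Rmult_0_r, sinh_0.
  replace (INR m * _) with (PI / 2 + INR k * PI) by (field; lra).
  rewrite cos_plus, cos_PI2, (sin_eq_0_1 (INR k * PI)).
  + apply injective_projections; simpl; ring.
  + exists (Z.of_nat k). now rewrite <- INR_IZR_INZ.
- unfold ccos, cheb_root. rewrite cosh_0, sinh_0.
  apply injective_projections; simpl; field.
Qed.

(** The [m] distinct roots exhaust the degree, so [is_poly_inv] applies; [c] is the inverse of the
    leading coefficient. *)
Lemma cheb_inv (m : nat) : (0 < m)%nat -> exists (c : R) (l : list R),
  l <> nil /\ NoDup l /\ (forall a, In a l -> 0 < a < 1) /\
  forall z : C, (forall a : R, In a l -> z <> a) -> cheb m z <> 0 /\ (/ cheb m z = c * prod_inv l z)%C.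
Proof.
intros Hm.
destruct m as [|m]; [lia|].
destruct (is_poly_cheb m) as [_ (c & Hc & Hp)].
exists (/ c), (map (cheb_root (S m)) (seq 0 (S m))).
assert (Hin : forall a, In a (map (cheb_root (S m)) (seq 0 (S m))) ->
  exists k, (k < S m)%nat /\ a = cheb_root (S m) k).
{ intros a Ha. apply in_map_iff in Ha. destruct Ha as (k & <- & Hk).
  apply in_seq in Hk. exists k. split; [lia|easy]. }
assert (Hnd : NoDup (map (cheb_root (S m)) (seq 0 (S m)))).
{ apply NoDup_map_NoDup_ForallPairs; [|apply seq_NoDup].
  intros k k' Hk Hk'. apply in_seq in Hk, Hk'. apply cheb_root_inj; lia. }
split; [easy|]. split; [easy|]. split.
- intros a Ha. destruct (Hin a Ha) as (k & Hk & ->). now apply cheb_root_bound.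
- intros z Hz. rewrite (RtoC_inv c Hc). apply is_poly_inv; [|exact Hnd|exact Hz| |].
  + intros E. now apply Hc, RtoC_inj.
  + rewrite length_map, length_seq. exact Hp.
  + intros a Ha. destruct (Hin a Ha) as (k & Hk & ->). now apply cheb_root_0.
Qed.

(** * Integrals along the unit circle *)

(* With [sin theta = t ^ 2], this is [exp (- 2 i theta)]. *)
Definition circ (t : R) : C := (1 - 2 * t ^ 4, - (2 * t ^ 2 * sqrt (1 - t ^ 4))).

Lemma pow4_lt_1 (t : R) : -1 < t < 1 -> 0 < 1 - t ^ 4.
Proof.
intros H. assert (H2 : 0 <= t ^ 2 < 1) by nra.
replace (t ^ 4) with (t ^ 2 * t ^ 2) by ring. nra.
Qed.

(** The imaginary part of [circ t] vanishes only at [t = 0], where [circ t = 1 > a]. *)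
Lemma circ_sub_neq_0 (a t : R) : -1 < t < 1 -> 0 < a < 1 -> (circ t - a)%C <> 0.
Proof.
intros Ht Ha E. assert (Hq := pow4_lt_1 t Ht).
assert (E1 := f_equal fst E). assert (E2 := f_equal snd E).
unfold circ in E1, E2. simpl in E1, E2.
assert (Hs := sqrt_sqrt (1 - t ^ 4) (Rlt_le _ _ Hq)).
assert (Hs' := sqrt_lt_R0 _ Hq).
set (r := sqrt (1 - t ^ 4)) in *.
change (sqrt _) with r in E2.
assert (H0 : t ^ 2 = 0) by nra.
replace (t ^ 4) with (t ^ 2 * t ^ 2) in * by ring.
simpl in E1, H0. nra.
Qed.

Lemma is_RInt_gen_ext_01 (f g : R -> R) (l : R) : (forall t, 0 < t < 1 -> f t = g t) ->
  is_RInt_gen f (at_point 0) (at_left 1) l -> is_RInt_gen g (at_point 0) (at_left 1) l.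
Proof.
intros E. apply is_RInt_gen_ext.
exists (fun x => x = 0) (fun y => 0 < y < 1).
- easy.
- exists (mkposreal 1 Rlt_0_1). intros y Hy Hy1.
  apply Rabs_lt_between' in Hy. simpl in Hy. lra.
- intros x y -> Hy t. simpl. rewrite Rmin_left, Rmax_right by lra.
  intros Ht. apply E. lra.
Qed.

Lemma is_RInt_gen_circ1 (a : R) : 0 < a < 1 ->
  is_RInt_gen (fun t => Re (/ (circ t - a)) * (t / sqrt (1 - t ^ 4)))
    (at_point 0) (at_left 1) 0.
Proof.
intros Ha.
(* This is [Arg (1 - a * circ t) / (4 a)]: the real part of [1 - a * circ t] is positive, so the
   argument is an arctangent. The extra factor 1/2 comes from
   [t dt / sqrt (1 - t ^ 4) = d theta / 2]. *)
set (G := fun t => / (4 * a) *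
  atan (a * (2 * t ^ 2 * sqrt (1 - t ^ 4)) * / (1 - a * (1 - 2 * t ^ 4)))).
set (g := fun t => Re (/ (circ t - a)) * (t / sqrt (1 - t ^ 4))).
assert (Hden : forall t, 0 < 1 - a * (1 - 2 * t ^ 4)).
{ intros t. assert (0 <= t ^ 4) by (replace (t ^ 4) with (t ^ 2 * t ^ 2) by ring; nra). nra. }
assert (HG : forall t, -1 < t < 1 -> is_derive G t (g t)).
{ intros t Ht. assert (Hq := pow4_lt_1 t Ht).
  assert (Hd := Hden t).
  assert (Hn := circ_sub_neq_0 a t Ht Ha).
  unfold G. auto_derive.
  - repeat split; simpl in *; lra.
  - unfold g, circ.
    assert (Hs := sqrt_sqrt (1 - t ^ 4) (Rlt_le _ _ Hq)).
    assert (Hs' := sqrt_lt_R0 _ Hq).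
    set (r := sqrt (1 - t ^ 4)) in *.
    (* [K] and [S] are the cosine and sine of [2 theta], whose derivative in [t] is [4 t / r]; [HdS]
       and [HdK] evaluate [dS/dt] and [- dK/dt] accordingly. *)
    set (K := 1 - 2 * t ^ 4). set (S := 2 * t ^ 2 * r).
    assert (HS : S * S = 1 - K * K).
    { unfold S, K. replace (2 * t ^ 2 * r * (2 * t ^ 2 * r)) with (4 * t ^ 4 * (r * r)) by ring.
      rewrite Hs. ring. }
    assert (HdS : 2 * (2 * t) * r + 2 * t ^ 2 * (- (4 * t ^ 3) * / (2 * r)) = 4 * t * K / r).
    { apply Rmult_eq_reg_r with r; [|lra].
      replace ((2 * (2 * t) * r + 2 * t ^ 2 * (- (4 * t ^ 3) * / (2 * r))) * r)
        with (4 * t * (r * r) - 4 * t ^ 5) by (field; lra).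
      rewrite Hs. unfold K. field. lra. }
    assert (HdK : 8 * t ^ 3 = 4 * t * S / r) by (unfold S; field; lra).
    assert (HE : 0 < 1 - a * K) by (unfold K; lra).
    (* This is the squared modulus of [circ t - a], at least [(1 - a) ^ 2]. *)
    assert (HD : 0 < 1 - 2 * a * K + a * a).
    { assert (K <= 1) by nra. nra. }
    transitivity (/ (4 * a) * ((a * (4 * t * K / r) * / (1 - a * K)
      - a * S * (a * (4 * t * S / r)) / ((1 - a * K) * (1 - a * K)))
      / (1 + a * a * (S * S) / ((1 - a * K) * (1 - a * K))))).
    + rewrite <- HdS, <- HdK. unfold S, K.
      simpl. change (sqrt (1 + - (t * (t * (t * (t * 1)))))) with r.
      assert (HE' : 0 < 1 - a * (1 - 2 * (t * (t * (t * t))))) by (simpl in Hd; lra).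
      field. repeat split; try lra.
      apply Rgt_not_eq, Rplus_lt_le_0_compat; [now apply Rmult_lt_0_compat|].
      apply Rmult_le_pos; apply Rle_0_sqr.
    + replace (a * S * (a * (4 * t * S / r))) with (a * a * (4 * t / r) * (S * S)) by (field; lra).
      change (Re (/ ((K, - S) - a))) with ((K - a) / ((K - a) ^ 2 + (- S + - 0) ^ 2)).
      replace ((K - a) ^ 2 + (- S + - 0) ^ 2) with (1 - 2 * a * K + a * a)
        by (transitivity ((K - a) ^ 2 + S * S); [rewrite HS|]; ring).
      rewrite HS. field. repeat split; try lra; try nra. }
assert (Hg : forall t, -1 < t < 1 -> continuous g t).
{ intros t Ht. assert (Hq := pow4_lt_1 t Ht).
  assert (Hs' := sqrt_lt_R0 _ Hq).
  assert (Hn := circ_sub_neq_0 a t Ht Ha).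
  apply (ex_derive_continuous g). unfold g, circ in *. simpl in *. auto_derive.
  change (1 + - (t * (t * (t * (t * 1))))) with (1 - t * (t * (t * (t * 1)))).
  set (r := sqrt (1 - t * (t * (t * (t * 1))))) in *.
  repeat split; try lra. intros E.
  destruct (Rplus_sqr_eq_0 (1 - 2 * (t * (t * (t * (t * 1)))) - a) (- (2 * (t * (t * 1)) * r)))
    as [E1 E2].
  { rewrite <- E. unfold Rsqr. ring. }
  apply Hn, injective_projections; simpl; fold r; lra. }
assert (HG1 : filterlim G (at_left 1) (locally 0)).
{ replace 0 with (G 1).
  (* Two-sided continuity holds at 1 because [sqrt] takes the value 0 on negative numbers. *)
  - cut (continuous G 1).
    { intros Hc P HP. exact (filter_le_within (fun u => u < 1) (fun x => P (G x)) (Hc P HP)). }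
    apply (continuous_mult (K := R_AbsRing)); [apply continuous_const|].
    apply (continuous_comp _ atan);
      [|apply continuity_pt_filterlim, derivable_continuous_pt, derivable_pt_atan].
    apply (continuous_mult (K := R_AbsRing)).
    + apply (continuous_mult (K := R_AbsRing)); [apply continuous_const|].
      apply (continuous_mult (K := R_AbsRing)).
      * apply (ex_derive_continuous (fun t => 2 * t ^ 2)). auto_derive. easy.
      * apply (continuous_comp _ sqrt); [|apply continuous_sqrt].
        apply (ex_derive_continuous (fun t => 1 - t ^ 4)). auto_derive. easy.
    + apply (ex_derive_continuous (fun t => / (1 - a * (1 - 2 * t ^ 4)))). auto_derive.
      simpl; lra.
  - unfold G. rewrite !pow1, Rminus_diag, sqrt_0, Rmult_0_r, Rmult_0_r, Rmult_0_l, atan_0. ring. }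
assert (HG0 : G 0 = 0).
{ unfold G. replace (_ * / (_ - _)) with 0 by (simpl; rewrite !Rmult_0_l, !Rmult_0_r; ring).
  rewrite atan_0. ring. }
(* The integral over [[0, y]] is [G y - G 0 = G y], which tends to 0 as [y] increases to 1. *)
intros P HP. assert (HP' := HG1 P HP).
exists (fun x => x = 0) (fun b => 0 < b < 1 /\ P (G b)).
- easy.
- apply filter_and; [|exact HP'].
  exists (mkposreal 1 Rlt_0_1). intros y Hy Hy1.
  apply Rabs_lt_between' in Hy. simpl in Hy. split; lra.
- intros x y -> [Hy HPy]. exists (G y). split; [|exact HPy].
  simpl. replace (G y) with (minus (G y) (G 0)) by (rewrite HG0; apply Rminus_0_r).
  apply (is_RInt_derive (V := R_CompleteNormedModule));
    rewrite Rmin_left, Rmax_right by lra; intros t Ht; [apply HG | apply Hg]; lra.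
Qed.

(** Since [1 / ((s - a) (s - b)) = (1 / (s - a) - 1 / (s - b)) / (a - b)], a product with two or
    more factors reduces to two products with one factor fewer; hence the induction on length. The
    list must be nonempty: the empty product would give [pi / 4]. *)
Lemma is_RInt_gen_circ (l : list R) : l <> nil -> NoDup l -> (forall a, In a l -> 0 < a < 1) ->
  is_RInt_gen (fun t => Re (prod_inv l (circ t)) * (t / sqrt (1 - t ^ 4)))
    (at_point 0) (at_left 1) 0.
Proof.
remember (length l) as n eqn:Hn. revert l Hn.
induction n as [|n IH]; intros [|a l] Hn Hl Hnd Hin; try easy.
destruct l as [|b l].
- generalize (is_RInt_gen_circ1 a (Hin a (or_introl eq_refl))).
  apply is_RInt_gen_ext. apply filter_forall. intros x t _.
  cbn [prod_inv]. now rewrite Cmult_1_r.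
- assert (Hab : a - b <> 0).
  { inversion_clear Hnd as [|? ? Ha _]. intros E. apply Ha. left. lra. }
  assert (Ha : 0 < a < 1) by (apply Hin; now left).
  assert (Hb : 0 < b < 1) by (apply Hin; right; now left).
  injection Hn as Hn.
  assert (Ia := IH (a :: l) Hn ltac:(easy)).
  assert (Ib := IH (b :: l) Hn ltac:(easy)).
  specialize (Ia ltac:(now apply (NoDup_remove_1 (a :: nil) l b))).
  specialize (Ib ltac:(now inversion Hnd)).
  specialize (Ia ltac:(intros x [Hx|Hx]; apply Hin; [now left|now right; right])).
  specialize (Ib ltac:(intros x Hx; apply Hin; now right)).
  assert (I := is_RInt_gen_scal _ (/ (a - b)) _ (is_RInt_gen_minus _ _ _ _ Ia Ib)).
  replace 0 with (scal (/ (a - b)) (minus 0 0)) at 2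
    by (unfold scal, minus, plus, opp; simpl; unfold mult; simpl; ring).
  revert I. apply is_RInt_gen_ext_01.
  intros t Ht. cbn [prod_inv].
  assert (Na := circ_sub_neq_0 a t ltac:(lra) Ha).
  assert (Nb := circ_sub_neq_0 b t ltac:(lra) Hb).
  replace (/ (circ t - a) * (/ (circ t - b) * prod_inv l (circ t)))%C
    with ((/ (a - b))%R * (/ (circ t - a) * prod_inv l (circ t)
           - / (circ t - b) * prod_inv l (circ t)))%C.
  + set (u := (/ (circ t - a) * _)%C). set (v := (/ (circ t - b) * _)%C).
    unfold scal, minus, plus, opp; simpl; unfold mult; simpl. ring.
  + rewrite RtoC_inv, RtoC_minus by easy. field. repeat split; try easy.
    intros E. rewrite <- RtoC_minus in E. now apply Hab, RtoC_inj.
Qed.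

(** * Return to the trigonometric integrand *)

(** With [w = arcsin t + i arcsinh t], [cos w = sqrt (1 - t ^ 4) - i t ^ 2] and [circ t] is its
    square, so this is the double angle formula. *)
Lemma circ_ccos (t : R) : -1 < t < 1 ->
  (2 * circ t - 1)%C = ccos (2 * asin t) (2 * arcsinh t).
Proof.
intros Ht. assert (Ht2 : t ^ 2 < 1) by nra.
assert (Hc := cosh_sq (arcsinh t)). rewrite sinh_arcsinh in Hc.
assert (Hsin : sin (asin t) = t) by (apply sin_asin; lra).
assert (Hcos := cos_asin t ltac:(lra)).
assert (Hs : sqrt (1 - t ^ 4) = cos (asin t) * cosh (arcsinh t)).
{ rewrite Hcos. replace (1 - t ^ 4) with ((1 - t²) * (cosh (arcsinh t))²)
    by (unfold Rsqr at 2; rewrite Hc; unfold Rsqr; ring).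
  assert (0 < cosh (arcsinh t)).
  { unfold cosh. assert (H1 := exp_pos (arcsinh t)).
    assert (H2 := exp_pos (- arcsinh t)). lra. }
  rewrite sqrt_mult by (unfold Rsqr; nra).
  now rewrite sqrt_Rsqr by lra. }
unfold ccos, circ. rewrite Hs.
rewrite cos_2a_sin, sin_2a, Hsin.
replace (2 * arcsinh t) with (arcsinh t + arcsinh t) by ring.
rewrite cosh_plus, sinh_plus, sinh_arcsinh, Hc.
apply injective_projections; simpl; ring.
Qed.

(** The denominator [cos (2 x) + cosh (2 y)] is twice the squared modulus of [cos (x + i y)]. *)
Lemma Re_inv_ccos (x y : R) : ccos x y <> 0 ->
  cos x * cosh y / (cos (2 * x) + cosh (2 * y)) = / 2 * Re (/ ccos x y).
Proof.
intros H. unfold ccos in *.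
replace (2 * y) with (y + y) by ring.
assert (Hc := cosh_sq y). assert (Hx := sin2_cos2 x). unfold Rsqr in Hx.
rewrite cos_2a_cos, cosh_plus.
set (D := (cos x * cosh y) ^ 2 + (- (sin x * sinh y)) ^ 2).
assert (HD : 2 * D = 2 * cos x * cos x - 1 + (cosh y * cosh y + sinh y * sinh y)).
{ unfold D.
  replace ((cos x * cosh y) ^ 2) with (cos x * cos x * (cosh y * cosh y)) by ring.
  replace ((- (sin x * sinh y)) ^ 2) with (sin x * sin x * (sinh y * sinh y)) by ring.
  replace (sin x * sin x) with (1 - cos x * cos x) by lra. rewrite Hc. ring. }
assert (HD0 : D <> 0).
{ intros E. apply H. unfold D in E.
  apply injective_projections; simpl; nra. }
rewrite <- HD.
change (Re (/ (cos x * cosh y, - (sin x * sinh y)))) with (cos x * cosh y / D).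
field. exact HD0.
Qed.

Lemma is_RInt_gen_even_nat (m : nat) : (0 < m)%nat ->
  is_RInt_gen
    (fun t : R =>
       (cos (INR m * (2 * asin t)) * cosh (INR m * (2 * arcsinh t)))
       / (cos (2 * (INR m * (2 * asin t))) + cosh (2 * (INR m * (2 * arcsinh t))))
       * (t / sqrt (1 - t ^ 4)))
    (at_point 0) (at_left 1) 0.
Proof.
intros Hm. destruct (cheb_inv m Hm) as (c & l & Hl & Hnd & Hin & Hinv).
assert (I := is_RInt_gen_scal _ (/ 2 * c) _ (is_RInt_gen_circ l Hl Hnd Hin)).
replace 0 with (scal (/ 2 * c) 0) at 2 by apply Rmult_0_r.
revert I. apply is_RInt_gen_ext_01. intros t Ht.
destruct (Hinv (circ t)) as [H0 H1].
{ intros a Ha E. apply (circ_sub_neq_0 a t); [lra|now apply Hin|].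
  rewrite E. ring. }
rewrite (cheb_ccos (2 * asin t) (2 * arcsinh t)) in H0, H1 by (apply circ_ccos; lra).
rewrite Re_inv_ccos, H1 by exact H0.
rewrite re_scal_l.
unfold scal; simpl; unfold mult; simpl. ring.
Qed.

Theorem theorem2 (n : Z) (hn0 : n <> 0%Z) (hn : Z.Even n) :
  is_RInt_gen
    (fun t : R =>
       (cos (IZR n * asin t) * cosh (IZR n * arcsinh t))
       / (cos (2 * IZR n * asin t) + cosh (2 * IZR n * arcsinh t))
       * (t / sqrt (1 - t ^ 4)))
    (at_point 0) (at_left 1) 0.
Proof.
destruct hn as [j ->].
(* Both [cos] and [cosh] are even, so [j] may be replaced by its absolute value. *)
generalize (is_RInt_gen_even_nat (Z.abs_nat j) ltac:(lia)).
apply is_RInt_gen_ext, filter_forall. intros ab t _.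
rewrite INR_IZR_INZ, Zabs2Nat.id_abs, abs_IZR, mult_IZR.
assert (E : forall x, 2 * (2 * IZR j) * x = 2 * (2 * IZR j * x)) by (intros; ring).
rewrite !E. clear E.
assert (E : forall x, IZR j * (2 * x) = 2 * IZR j * x) by (intros; ring).
destruct (Rcase_abs (IZR j)) as [Hj|Hj].
- rewrite (Rabs_left _ Hj), <- !Ropp_mult_distr_l, <- !Ropp_mult_distr_r, !E.
  now rewrite !cos_neg, !cosh_opp.
- now rewrite (Rabs_right _ Hj), !E.
Qed.
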